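(* Let $\mathbb{K}$ be a field of characteristic $\neq 2$, let $A=(A_{ij})$ be a Cartan matrix of size $n$ over $\mathbb{K}$ (of a Lie superalgebra), and let $I=(p_1,\dots,p_n)\in(\mathbb{Z}/2)^n$ be the vector of parities. If $p_k=\bar 1$ and $A_{kk}=0$, then the reflection in the $k$th simple odd root sends $A$ to the matrix $r_k(A)$ with entries \[ (r_k(A))_{ij}=A_{ij}+b_iA_{kj}+c_jA_{ik}, \] where \[ b_i=\begin{cases}-2&\text{if } i=k,\\ 0&\text{if } i\neq k \text{ and } A_{ik}=0,\\ \frac{A_{ik}}{A_{ki}}&\text{if } i\neq k\text{ and }A_{ik}\neq 0,\end{cases} \qquad c_j=\begin{cases}-2&\text{if } j=k,\\ 0&\text{if } j\neq k \text{ and } A_{jk}=0,\\ 1&\text{if } j\neq k\text{ and }A_{jk}\neq 0.\end{cases} \] The reflected matrix $r_k(A)$ might have to be normalized; the new parities are $\widetilde p_j\equiv p_j+c_j \pmod 2$. In terms of matrices, $r_k(A)=(E+B)A(E+C)$, where $E$ is the unit $n\times n$ matrix, $B$ is the $n\times n$ matrix all of whose columns except the $k$th one are zero, the $i$th coordinate of the $k$th column being $b_i$, and $C$ is the $n\times n$ matrix all of whose rows except the $k$th one are zero, the $i$th coordinate of the $k$th row being $c_i$. Therefore $B^2=C^2=0$, and, for $A$ invertible, \[ (r_k(A))^{-1}=(E-C)\,A^{-1}\,(E-B). \]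
   Context: Given an $n\times n$ matrix $A$ over $\mathbb{K}$ of rank $n-l$ and parities $I=(p_1,\dots,p_n)$, the Lie superalgebra with Cartan matrix $A$ is constructed as follows. Take generators $e_i^\pm$ of parity $p_i$ and $h_i$ ($i=1,\dots,n$) subject to the relations $[e_i^+,e_j^-]=\delta_{ij}h_i$, $[h_i,e_j^\pm]=\pm A_{ij}e_j^\pm$, $[h_i,h_j]=0$. Add grading elements $d_1,\dots,d_l$ with $[d_i,e_j^\pm]=\pm D_{ij}e_j^\pm$, $[d_i,d_j]=[d_i,h_j]=0$, where $D$ is an $l\times n$ matrix such that $A$ and $D$ stacked on top of each other form a matrix of rank $n$. Then factor out the maximal ideal among those that intersect the span of all the $h_i$ and $d_j$ by zero. The elements $e_i^\pm$ (and $h_i$) are called Chevalley generators, and the simple root number $i$ is the degree of $e_i^+$ in the $\mathbb{Z}^n$-grading in which $e_i^\pm$ has degree $(0,\dots,0,\pm1,0,\dots,0)$ with $\pm1$ in the $i$th slot. The reflection in the $k$th simple root with $p_k=\bar 1$ and $A_{kk}=0$ replaces the Chevalley generators by $\tilde e_k^\pm=e_k^\mp$ and, for $j\neq k$, $\tilde e_j^\pm=[e_k^\pm,e_j^\pm]$ if $A_{kj}\neq0$ and $\tilde e_j^\pm=e_j^\pm$ otherwise. The reflected Cartan matrix is read off from $[\tilde h_i,\tilde e_j^+]$, where $\tilde h_i=[\tilde e_i^+,\tilde e_i^-]$, up to normalization. To normalize a Cartan matrix means to multiply it on the left by an invertible diagonal matrix so that each diagonal entry becomes $0$, $1$ or $2$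 (with $2$ only in rows of even parity).
   Formalization: Assumes A_ik=0 iff A_ki=0 (else b_i is undefined or the parity rule fails); B²=C²=0 is false and is replaced by B²=-2B, C²=-2C, and the inverse is corrected to (E+C)A^{-1}(E+B); the maximal ideal is taken among Z^n-graded ones. *)

(* Defs.v *)
From mathcomp Require Import all_boot all_order all_algebra.

Set Implicit Arguments.
Unset Strict Implicit.
Unset Printing Implicit Defensive.

Import GRing.Theory.
Local Open Scope ring_scope.

(* Lie superalgebras over a field of characteristic different from 2.  The
   parities are booleans ([true] is odd, addition in Z/2 is [(+)]), and
   [lsa_part q x] says that x lies in the homogeneous component of parity q.
   The last axiom follows from the Jacobi identity unless the characteristic
   is 3, where it is part of the definition. *)
Record lieSuperalgebra (K : fieldType) := LieSuperalgebra {
  lsa_car :> lmodType K;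
  lsa_part : bool -> lsa_car -> Prop;
  lsa_br : lsa_car -> lsa_car -> lsa_car;
  lsa_part0 : forall q, lsa_part q 0;
  lsa_part_lin : forall q (a : K) x y,
    lsa_part q x -> lsa_part q y -> lsa_part q (a *: x + y);
  lsa_part_sum : forall x, exists x0 x1,
    [/\ lsa_part false x0, lsa_part true x1 & x = x0 + x1];
  lsa_part_direct : forall x, lsa_part false x -> lsa_part true x -> x = 0;
  lsa_br_linl : forall y, linear (fun x => lsa_br x y);
  lsa_br_linr : forall x, linear (fun y => lsa_br x y);
  lsa_br_part : forall q r x y,
    lsa_part q x -> lsa_part r y -> lsa_part (q (+) r) (lsa_br x y);
  lsa_br_skew : forall q r x y, lsa_part q x -> lsa_part r y ->
    lsa_br x y = - ((-1) ^+ (q && r) *: lsa_br y x);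
  lsa_br_jacobi : forall q r x y z, lsa_part q x -> lsa_part r y ->
    lsa_br x (lsa_br y z) =
      lsa_br (lsa_br x y) z + (-1) ^+ (q && r) *: lsa_br y (lsa_br x z);
  lsa_br_cube : forall x, lsa_part true x -> lsa_br x (lsa_br x x) = 0
}.

Definition lsa_hom (K : fieldType) (L M : lieSuperalgebra K) (f : L -> M) :=
  [/\ linear f,
      forall q x, lsa_part q x -> lsa_part q (f x)
    & forall x y, f (lsa_br x y) = lsa_br (f x) (f y)].

(* [chev_e c true i] is e_i^+ and [chev_e c false i] is e_i^-. *)
Record chevalley (K : fieldType) (n l : nat) (L : lieSuperalgebra K) :=
  Chevalley {
    chev_e : bool -> 'I_n -> L;
    chev_h : 'I_n -> L;
    chev_d : 'I_l -> L
  }.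

Definition chevalley_map (K : fieldType) (n l : nat) (L M : lieSuperalgebra K)
    (f : L -> M) (c : chevalley n l L) : chevalley n l M :=
  Chevalley (fun s i => f (chev_e c s i)) (fun i => f (chev_h c i))
            (fun i => f (chev_d c i)).

(* The scalar of a sign: [true] is +1 and [false] is -1. *)
Definition sgn_of (K : fieldType) (s : bool) : K := if s then 1 else -1.

Record chevalley_relations (K : fieldType) (n l : nat) (A : 'M[K]_n)
    (D : 'M[K]_(l, n)) (p : 'I_n -> bool) (L : lieSuperalgebra K)
    (c : chevalley n l L) : Prop := ChevalleyRelations {
  rel_e_part : forall s i, lsa_part (p i) (chev_e c s i);
  rel_h_part : forall i, lsa_part false (chev_h c i);
  rel_d_part : forall i, lsa_part false (chev_d c i);
  rel_ee : forall i j,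
    lsa_br (chev_e c true i) (chev_e c false j) = chev_h c i *+ (i == j);
  rel_he : forall s i j,
    lsa_br (chev_h c i) (chev_e c s j) = (sgn_of K s * A i j) *: chev_e c s j;
  rel_hh : forall i j, lsa_br (chev_h c i) (chev_h c j) = 0;
  rel_de : forall s i j,
    lsa_br (chev_d c i) (chev_e c s j) = (sgn_of K s * D i j) *: chev_e c s j;
  rel_dd : forall i j, lsa_br (chev_d c i) (chev_d c j) = 0;
  rel_dh : forall i j, lsa_br (chev_d c i) (chev_h c j) = 0
}.

(* (L, c) is the Lie superalgebra given by the generators c and the relations
   above, i.e. it has the universal property of the presentation. *)
Definition presented_by_chevalley (K : fieldType) (n l : nat) (A : 'M[K]_n)
    (D : 'M[K]_(l, n)) (p : 'I_n -> bool) (L : lieSuperalgebra K)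
    (c : chevalley n l L) : Prop :=
  chevalley_relations A D p c /\
  forall (M : lieSuperalgebra K) (c' : chevalley n l M),
    chevalley_relations A D p c' ->
    exists f : L -> M,
      [/\ lsa_hom f,
          [/\ forall s i, f (chev_e c s i) = chev_e c' s i,
              forall i, f (chev_h c i) = chev_h c' i
            & forall i, f (chev_d c i) = chev_d c' i]
        & forall f' : L -> M, lsa_hom f' ->
            [/\ forall s i, f' (chev_e c s i) = chev_e c' s i,
                forall i, f' (chev_h c i) = chev_h c' i
              & forall i, f' (chev_d c i) = chev_d c' i] ->
            forall x, f' x = f x].

(* The Z^n-grading of the presented superalgebra:
   deg e_i^+- = (0, ..., +-1, ..., 0) and deg h_i = deg d_i = 0. *)
Inductive has_degree (K : fieldType) (n l : nat) (L : lieSuperalgebra K)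
    (c : chevalley n l L) : 'rV[int]_n -> L -> Prop :=
| Deg_ep i : has_degree c (delta_mx 0 i) (chev_e c true i)
| Deg_em i : has_degree c (- delta_mx 0 i) (chev_e c false i)
| Deg_h i : has_degree c 0 (chev_h c i)
| Deg_d i : has_degree c 0 (chev_d c i)
| Deg_0 g : has_degree c g 0
| Deg_lin g (a : K) x y :
    has_degree c g x -> has_degree c g y -> has_degree c g (a *: x + y)
| Deg_br g g' x y :
    has_degree c g x -> has_degree c g' y -> has_degree c (g + g') (lsa_br x y).

Definition lsa_ideal (K : fieldType) (L : lieSuperalgebra K) (J : L -> Prop) :=
  [/\ J 0, forall (a : K) x y, J x -> J y -> J (a *: x + y)
    & forall x y, J y -> J (lsa_br x y) /\ J (lsa_br y x)].

(* J is the sum of its Z^n-homogeneous components. *)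
Definition homogeneous (K : fieldType) (n l : nat) (L : lieSuperalgebra K)
    (c : chevalley n l L) (J : L -> Prop) :=
  forall x, J x -> exists s : seq L,
    (forall y, y \in s -> J y /\ exists g, has_degree c g y) /\
    x = \sum_(y <- s) y.

Definition in_cartan (K : fieldType) (n l : nat) (L : lieSuperalgebra K)
    (c : chevalley n l L) (x : L) :=
  exists (a : 'I_n -> K) (b : 'I_l -> K),
    x = \sum_i a i *: chev_h c i + \sum_i b i *: chev_d c i.

(* Homogeneous ideals whose intersection with the span of the h_i and d_j is
   zero.  In characteristic 0 every ideal is homogeneous, the roots being
   linearly independent on this span.  In positive characteristic a sum of
   non-homogeneous ideals with this property may fail to have it, and only
   the homogeneous ones have a largest element; homogeneity is also what makes
   the quotient Z^n-graded. *)
Definition cartan_free_ideal (K : fieldType) (n l : nat)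
    (L : lieSuperalgebra K) (c : chevalley n l L) (J : L -> Prop) :=
  [/\ lsa_ideal J, homogeneous c J & forall x, J x -> in_cartan c x -> x = 0].

Definition maximal_cartan_free_ideal (K : fieldType) (n l : nat)
    (L : lieSuperalgebra K) (c : chevalley n l L) (J : L -> Prop) :=
  cartan_free_ideal c J /\
  forall J' : L -> Prop, cartan_free_ideal c J' -> forall x, J' x -> J x.

(* (g, c) is the Lie superalgebra with Cartan matrix A, parities p and grading
   matrix D, together with its Chevalley generators: the quotient of the
   presented superalgebra by the maximal ideal above. *)
Definition superalgebra_with_cartan_matrix (K : fieldType) (n l : nat)
    (A : 'M[K]_n) (D : 'M[K]_(l, n)) (p : 'I_n -> bool)
    (g : lieSuperalgebra K) (c : chevalley n l g) : Prop :=
  [/\ (\rank A + l)%N = n, \rank (col_mx A D) = n &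
      exists (gt : lieSuperalgebra K) (ct : chevalley n l gt) (f : gt -> g),
        [/\ presented_by_chevalley A D p ct,
            lsa_hom f,
            forall y, exists x, f x = y,
            c = chevalley_map f ct
          & maximal_cartan_free_ideal ct (fun x => f x = 0)]].

Section Reflection.

Variables (K : fieldType) (n : nat) (A : 'M[K]_n) (k : 'I_n).

Definition reflected_e (l : nat) (g : lieSuperalgebra K) (c : chevalley n l g)
    (s : bool) (j : 'I_n) : g :=
  if j == k then chev_e c (~~ s) k
  else if A k j != 0 then lsa_br (chev_e c s k) (chev_e c s j)
  else chev_e c s j.

Definition reflected_h (l : nat) (g : lieSuperalgebra K) (c : chevalley n l g)
    (i : 'I_n) : g :=
  lsa_br (reflected_e c true i) (reflected_e c false i).

(* M is read off from the brackets of the reflected generators. *)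
Definition reflected_cartan_matrix (l : nat) (g : lieSuperalgebra K)
    (c : chevalley n l g) (M : 'M[K]_n) : Prop :=
  forall i j,
    lsa_br (reflected_h c i) (reflected_e c true j)
      = M i j *: reflected_e c true j.

Definition refl_b (i : 'I_n) : K :=
  if i == k then -2 else if A i k == 0 then 0 else A i k / A k i.

(* Integers, because they also enter the new parities. *)
Definition refl_c (j : 'I_n) : int :=
  if j == k then -2 else if A j k == 0 then 0 else 1.

Definition refl_mx : 'M[K]_n :=
  \matrix_(i, j) (A i j + refl_b i * A k j + (refl_c j)%:~R * A i k).

Definition refl_B : 'M[K]_n :=
  \matrix_(i, j) (if j == k then refl_b i else 0).

Definition refl_C : 'M[K]_n :=
  \matrix_(i, j) (if i == k then (refl_c j)%:~R else 0).

End Reflection.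

(* N is obtained from M by left multiplication by an invertible diagonal
   matrix, the operation by which Cartan matrices are normalized. *)
Definition row_rescaling (K : fieldType) (n : nat) (M N : 'M[K]_n) : Prop :=
  exists t : 'rV[K]_n, (forall i, t 0 i != 0) /\ N = diag_mx t *m M.

(* Main.v *)
Require Import Defs.
From HB Require Import structures.
From mathcomp Require Import all_boot all_order all_algebra.
From mathcomp Require Import boolp functions ring.

Set Implicit Arguments.
Unset Strict Implicit.
Unset Printing Implicit Defensive.

Import GRing.Theory.
Local Open Scope ring_scope.

(* In the presented superalgebra no h_i vanishes: it acts on the Verma module
   of a highest weight that is nonzero on every h_i.  The Verma module is free
   over the e_j^-, so it is spanned by the words in the letters 1, ..., n, with
   e_j^- prepending the letter j; here formal infinite sums of words are
   allowed, which makes its elements plain functions on words.  An ideal that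
   meets the span of the h_i and d_j trivially cannot contain h_i, hence
   [e_i^+, e_i^-] = h_i shows that the Chevalley generators of the quotient are
   nonzero, and so are the reflected ones because the bracket with e_k^-+
   inverts the bracket with e_k^+- up to a nonzero scalar.  The eigenvalues are
   therefore well defined, and the Jacobi identity gives, for i <> k with
   A_ki <> 0,
   [e~_i^+, e~_i^-] = (-1)^(p_i) (A_ki h_i + A_ik h_k). *)

(** * The Lie superalgebra of an associative algebra graded by conjugation with [P] *)

Section InvolutionSuperalgebra.

Variables (K : fieldType) (R : algType K) (P : R).
Hypotheses (hK : 2%N \notin [pchar K]) (PP : P * P = 1).

Let two_neq0 : (2 : K) != 0.
Proof. by move: hK; rewrite inE /=. Qed.

Definition twist (x : R) : R := P * x * P.

(** As [twist] squares to the identity and 2 is invertible, its eigenspaces for 1 and -1 decompose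
    [R]: the even part commutes with [P], the odd part anticommutes. *)
Definition inv_part (q : bool) (x : R) : Prop := twist x = (-1) ^+ q *: x.

Definition even_comp (x : R) : R := 2^-1 *: (x + twist x).
Definition odd_comp (x : R) : R := 2^-1 *: (x - twist x).

(* For x of parity q and y of parity r this is x y - (-1)^(q r) y x, since
   conjugation by P multiplies y by (-1)^r. *)
Definition inv_br (x y : R) : R :=
  x * y - y * even_comp x - twist y * odd_comp x.

Lemma twist_lin : linear twist.
Proof.
by move=> a x y; rewrite /twist mulrDr mulrDl -scalerAr -scalerAl.
Qed.

Lemma twistZ a x : twist (a *: x) = a *: twist x.
Proof. by rewrite /twist -scalerAr -scalerAl. Qed.

Lemma twistD x y : twist (x + y) = twist x + twist y.
Proof. by rewrite /twist mulrDr mulrDl. Qed.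

Lemma twistN x : twist (- x) = - twist x.
Proof. by rewrite /twist mulrN mulNr. Qed.

Lemma twistM x y : twist (x * y) = twist x * twist y.
Proof. by rewrite /twist !mulrA -[P * x * P * P]mulrA PP mulr1. Qed.

Lemma twistK x : twist (twist x) = x.
Proof. by rewrite /twist !mulrA PP mul1r -mulrA PP mulr1. Qed.

Lemma even_odd_comp x : even_comp x + odd_comp x = x.
Proof.
rewrite /even_comp /odd_comp -scalerDr addrACA subrr addr0 -mulr2n.
by rewrite -scaler_nat scalerA mulVf ?scale1r.
Qed.

Lemma even_comp_lin : linear even_comp.
Proof.
move=> a x y; rewrite /even_comp twist_lin addrACA -scalerDr [LHS]scalerDr.
by rewrite !scalerA [2^-1 * a]mulrC.
Qed.

Lemma odd_comp_lin : linear odd_comp.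
Proof.
move=> a x y; rewrite /odd_comp twist_lin opprD addrACA -scalerBr [LHS]scalerDr.
by rewrite !scalerA [2^-1 * a]mulrC.
Qed.

Lemma even_comp_part q x : inv_part q x -> even_comp x = (~~ q)%:R *: x.
Proof.
rewrite /even_comp => ->; case: q => /=; rewrite ?expr1 ?expr0.
  by rewrite scaleN1r subrr scaler0 scale0r.
by rewrite !scale1r -mulr2n -scaler_nat scalerA mulVf ?scale1r.
Qed.

Lemma odd_comp_part q x : inv_part q x -> odd_comp x = q%:R *: x.
Proof.
rewrite /odd_comp => ->; case: q => /=; rewrite ?expr1 ?expr0.
  by rewrite scaleN1r opprK -mulr2n -scaler_nat scalerA mulVf ?scale1r.
by rewrite !scale1r subrr scaler0 scale0r.
Qed.

(** Only [x] has to be homogeneous here, so the Jacobi identity can be expanded for an arbitrary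
    third argument. *)
Lemma inv_br_homo q x y : inv_part q x ->
  inv_br x y = x * y - iter q twist y * x.
Proof.
move=> xq; rewrite /inv_br (even_comp_part xq) (odd_comp_part xq).
by case: q {xq} => /=; rewrite ?scale0r ?scale1r ?mulr0 subr0.
Qed.

Lemma iter_twist_part (q r : bool) y : inv_part r y ->
  iter q twist y = (-1) ^+ (q && r) *: y.
Proof. by case: q => //= _; rewrite expr0 scale1r. Qed.

Lemma iter_twistM (q : bool) x y :
  iter q twist (x * y) = iter q twist x * iter q twist y.
Proof. by case: q => //=; exact: twistM. Qed.

Lemma iter_twistB (q : bool) x y :
  iter q twist (x - y) = iter q twist x - iter q twist y.
Proof. by case: q => //=; rewrite twistD twistN. Qed.

Lemma iter_twistC (q r : bool) x :
  iter q twist (iter r twist x) = iter r twist (iter q twist x).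
Proof. by case: q; case: r. Qed.

Lemma iter_twist_addb (q r : bool) x :
  iter (q (+) r) twist x = iter q twist (iter r twist x).
Proof. by case: q; case: r => //=; rewrite twistK. Qed.

Lemma inv_part0 q : inv_part q 0.
Proof. by rewrite /inv_part /twist mulr0 mul0r scaler0. Qed.

Lemma inv_part_lin q (a : K) x y :
  inv_part q x -> inv_part q y -> inv_part q (a *: x + y).
Proof.
rewrite /inv_part => xq yq.
by rewrite twist_lin xq yq scalerDr !scalerA mulrC.
Qed.

Lemma inv_part_sum x : exists x0 x1,
  [/\ inv_part false x0, inv_part true x1 & x = x0 + x1].
Proof.
exists (even_comp x), (odd_comp x); split; last by rewrite even_odd_comp.
  by rewrite /inv_part twistZ twistD twistK addrC expr0 scale1r.
rewrite /inv_part twistZ twistD twistN twistK expr1 scaleN1r.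
by rewrite -scalerN opprB.
Qed.

Lemma inv_part_direct x : inv_part false x -> inv_part true x -> x = 0.
Proof.
move=> x0 x1; rewrite -(even_odd_comp x) (even_comp_part x1).
by rewrite (odd_comp_part x0) !scale0r addr0.
Qed.

Lemma inv_br_linl y : linear (fun x => inv_br x y).
Proof.
move=> a x x'; rewrite /inv_br even_comp_lin odd_comp_lin !mulrDr mulrDl.
rewrite -scalerAl -!scalerAr !opprD [X in X + _ = _]addrACA [LHS]addrACA.
by rewrite [a *: (_ - _ - _)]scalerBr [a *: (_ - _)]scalerBr.
Qed.

Lemma inv_br_linr x : linear (inv_br x).
Proof.
move=> a y y'; rewrite /inv_br twist_lin !mulrDr !mulrDl.
rewrite -!scalerAl -scalerAr !opprD [X in X + _ = _]addrACA [LHS]addrACA.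
by rewrite [a *: (_ - _ - _)]scalerBr [a *: (_ - _)]scalerBr.
Qed.

Lemma inv_br_part q r x y : inv_part q x -> inv_part r y ->
  inv_part (q (+) r) (inv_br x y).
Proof.
move=> xq yr; rewrite (inv_br_homo _ xq) (iter_twist_part _ yr).
rewrite /inv_part twistD twistN !twistM twistZ xq yr signr_addb.
rewrite -!(scalerAl, scalerAr) scalerBr !scalerA. 
by congr (_ *: _ - _ *: _); ring.
Qed.

Lemma inv_br_skew q r x y : inv_part q x -> inv_part r y ->
  inv_br x y = - ((-1) ^+ (q && r) *: inv_br y x).
Proof.
move=> xq yr; rewrite (inv_br_homo _ xq) (inv_br_homo _ yr).
rewrite (iter_twist_part _ yr) (iter_twist_part _ xq) andbC.
rewrite -!scalerAl scalerBr opprB scalerA -signr_addb addbb.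
by rewrite expr0 scale1r.
Qed.

Lemma inv_br_jacobi q r x y z : inv_part q x -> inv_part r y ->
  inv_br x (inv_br y z) =
    inv_br (inv_br x y) z + (-1) ^+ (q && r) *: inv_br y (inv_br x z).
Proof.
move=> xq yr; rewrite (inv_br_homo z (inv_br_part xq yr)).
rewrite !(inv_br_homo _ xq) !(inv_br_homo _ yr).
rewrite !iter_twistB !iter_twistM iter_twist_addb (iter_twistC r).
rewrite (iter_twist_part q yr) (iter_twist_part r xq) [r && q]andbC.
set s := (-1) ^+ (q && r); set zq := iter q twist z.
set zr := iter r twist z; set zqr := iter q twist zr.
have ss : s * s = 1 by rewrite /s -signr_addb addbb expr0.
rewrite !(mulrBl, mulrBr, scalerBr, opprB) -!(scalerAl, scalerAr).
rewrite !scalerA ss !scale1r !mulrA.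
(* On the right the terms in [y * x * z] and in [zqr * x * y] cancel; four terms remain on each
   side. *)
rewrite [RHS]addrACA !subrKA [LHS]addrACA [RHS]addrACA.
by congr (_ + _); exact: addrC.
Qed.

Lemma inv_br_cube x : inv_part true x -> inv_br x (inv_br x x) = 0.
Proof.
move=> x1; rewrite !(inv_br_homo _ x1) (iter_twist_part true x1) /= expr1.
by rewrite scaleN1r mulNr opprK twistD twistM x1 expr1 scaleN1r mulrNN
  mulrDr mulrDl mulrA subrr.
Qed.

Definition involution_superalgebra : lieSuperalgebra K :=
  LieSuperalgebra inv_part0 inv_part_lin inv_part_sum inv_part_direct
    inv_br_linl inv_br_linr inv_br_part inv_br_skew inv_br_jacobi inv_br_cube.

End InvolutionSuperalgebra.


(** * The algebra of linear operators on functions on words *)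

Section LinearOperators.

Variables (K : fieldType) (T : Type).

Local Notation V := (seq T -> K^o).

(** With linearity as a boolean predicate, operators form a subtype of [V -> V] and inherit its
    choice and module structures. *)
Record linop := LinOp { linop_fun :> V -> V; _ : `[< linear linop_fun >] }.

HB.instance Definition _ := [isSub of linop for linop_fun].
HB.instance Definition _ := [Choice of linop by <:].

Lemma linopP (f : linop) : linear f.
Proof. by case: f => f /= /asboolP. Qed.

Lemma linop_closed :
  GRing.subsemimod_closed (fun f : V -> V => `[< linear f >]).
Proof.
split; first split.
- by apply/asboolP => a x y; rewrite scaler0 add0r.
- move=> f g /asboolP lf /asboolP lg; apply/asboolP => a x y.
  by rewrite -[LHS]/(f (a *: x + y) + g (a *: x + y)) lf lg addrACA -scalerDr.
- move=> b f /asboolP lf; apply/asboolP => a x y.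
  rewrite -[LHS]/(b *: f (a *: x + y)) lf scalerDr scalerA mulrC -scalerA.
  by [].
Qed.

HB.instance Definition _ :=
  GRing.SubChoice_isSubLmodule.Build K (V -> V) _ linop linop_closed.

Lemma linop_eqP (f g : linop) : f =1 g -> f = g.
Proof. by move=> fg; apply/val_inj/funext. Qed.

Lemma linop_scaleE a (f : linop) x : (a *: f) x = a *: f x.
Proof. by []. Qed.

Lemma linop_id_subproof : `[< linear (fun x : V => x) >].
Proof. by apply/asboolP => a x y. Qed.

Definition linop_id := LinOp linop_id_subproof.

Lemma linop_comp_subproof (f g : linop) : `[< linear (fun x => f (g x)) >].
Proof. by apply/asboolP => a x y; rewrite !linopP. Qed.

Definition linop_comp f g := LinOp (linop_comp_subproof f g).

Lemma linop_compA : associative linop_comp.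
Proof. by move=> f g h; apply: linop_eqP. Qed.

Lemma linop_comp1l : left_id linop_id linop_comp.
Proof. by move=> f; apply: linop_eqP. Qed.

Lemma linop_comp1r : right_id linop_id linop_comp.
Proof. by move=> f; apply: linop_eqP. Qed.

Lemma linop_compDl : left_distributive linop_comp +%R.
Proof. by move=> f g h; apply: linop_eqP. Qed.

Lemma linop_compDr : right_distributive linop_comp +%R.
Proof.
move=> f g h; apply: linop_eqP => x.
by have := linopP f 1 (g x) (h x); rewrite !scale1r.
Qed.

Lemma linop_id_neq0 : linop_id != 0.
Proof.
apply/eqP => /(congr1 (fun f : linop => f (fun=> 1) [::])) /= /eqP.
by rewrite oner_eq0.
Qed.

HB.instance Definition _ := GRing.Zmodule_isNzRing.Build linop
  linop_compA linop_comp1l linop_comp1r linop_compDl linop_compDr linop_id_neq0.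

Lemma linop_mulE (f g : linop) x : (f * g) x = f (g x).
Proof. by []. Qed.

Lemma linop_scaleAl (a : K) (f g : linop) : a *: (f * g) = a *: f * g.
Proof. by apply: linop_eqP. Qed.

HB.instance Definition _ := GRing.Lmodule_isLalgebra.Build K linop
  linop_scaleAl.

Lemma linop_scaleAr (a : K) (f g : linop) : a *: (f * g) = f * (a *: g).
Proof.
apply: linop_eqP => x; rewrite linop_scaleE !linop_mulE linop_scaleE.
have f0 : f 0 = 0.
  by have := linopP f (-1) 0 0; rewrite scaleN1r oppr0 addr0 scaleN1r addNr.
by have := linopP f a (g x) 0; rewrite f0 !addr0 => ->.
Qed.

HB.instance Definition _ := GRing.Lalgebra_isAlgebra.Build K linop
  linop_scaleAr.

End LinearOperators.

(** * Diagonal, creation and annihilation operators *)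

Section WordOperators.

Variables (K : fieldType) (T : eqType).

Local Notation V := (seq T -> K^o).

Lemma diag_subproof (m : seq T -> K) :
  `[< linear (fun (phi : V) w => m w * phi w : K^o) >].
Proof.
apply/asboolP => a x y; apply/funext => w.
rewrite -[LHS]/(m w * (a * x w + y w)) -[RHS]/(a * (m w * x w) + m w * y w).
by rewrite mulrDr mulrCA.
Qed.

Definition diag_op m : linop K T := LinOp (diag_subproof m).

Lemma create_subproof (i : T) :
  `[< linear (fun (phi : V) w =>
        if w is a :: w' then (i == a)%:R * phi w' else 0 : K^o) >].
Proof.
apply/asboolP => a x y; apply/funext => -[|b w].
  by rewrite -[RHS]/(a * 0 + 0) mulr0 addr0.
rewrite -[LHS]/((i == b)%:R * (a * x w + y w)).
rewrite -[RHS]/(a * ((i == b)%:R * x w) + (i == b)%:R * y w).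
by rewrite mulrDr mulrCA.
Qed.

Definition create_op i : linop K T := LinOp (create_subproof i).

(* With a function phi standing for the formal sum of the phi(w) w, this is the
   coefficient at w of the image of phi under the operator E defined by
   E(empty word) = 0 and E(b u) = (i == b) d(u) u + s(b) b E(u). *)
Fixpoint annih (d : seq T -> K) (s : T -> K) (i : T) (phi : V) (w : seq T)
    : K :=
  d w * phi (i :: w) +
  if w is b :: w' then s b * annih d s i (fun u => phi (b :: u)) w' else 0.

Lemma annih_subproof d s i : `[< linear (annih d s i : V -> V) >].
Proof.
apply/asboolP => a x y; apply/funext => w.
rewrite -[RHS]/(a * annih d s i x w + annih d s i y w).
elim: w x y => [|b w IHw] x y /=.
  rewrite -[(a *: x + y) _]/(a * x [:: i] + y [:: i]).
  by ring.
rewrite -[(a *: x + y) _]/(a * x [:: i, b & w] + y [:: i, b & w]).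
have -> : (fun u => (a *: x + y) (b :: u)) =
    a *: (fun u => x (b :: u)) + (fun u => y (b :: u)) by [].
by rewrite IHw; ring.
Qed.

Definition annih_op d s i : linop K T := LinOp (annih_subproof d s i).

(** The coefficient at [w] only involves [phi] at words obtained by inserting [i] into [w]. These
    are permutations of [i :: w], so [m] is constant on them. *)
Lemma annih_diag d s i (m : seq T -> K) phi w :
  (forall u v, perm_eq u v -> m u = m v) ->
  annih d s i (fun u => m u * phi u) w = m (i :: w) * annih d s i phi w.
Proof.
elim: w m phi => [|b w IHw] m phi m_perm /=; first by ring.
rewrite (IHw (fun u => m (b :: u)) (fun u => phi (b :: u))); last first.
  by move=> u v uv; apply: m_perm; rewrite perm_cons.
rewrite (m_perm [:: b, i & w] [:: i, b & w]); first by ring.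
by rewrite -[_ :: _ :: _]/([:: b] ++ [:: i] ++ w) perm_catCA.
Qed.

Lemma diag_mul m m' : diag_op m * diag_op m' = diag_op (fun w => m w * m' w).
Proof. by apply: linop_eqP => x; apply/funext => w; exact: mulrA. Qed.

Lemma diag_comm m m' : diag_op m * diag_op m' = diag_op m' * diag_op m.
Proof.
by rewrite !diag_mul; congr diag_op; apply/funext => w; rewrite mulrC.
Qed.

(** The affine law treats signs (a = 1 or -1, b = 0) and weights (a = 1) at once. *)
Lemma annih_diag_op d s i m a b :
  (forall u v, perm_eq u v -> m u = m v) ->
  (forall w, m w = a * m (i :: w) + b) ->
  diag_op m * annih_op d s i =
    a *: (annih_op d s i * diag_op m) + b *: annih_op d s i.
Proof.
move=> m_perm m_cons; apply: linop_eqP => x; apply/funext => w.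
rewrite -[LHS]/(m w * annih d s i x w).
rewrite -[RHS]/(a * annih d s i (fun u => m u * x u) w + b * annih d s i x w).
by rewrite annih_diag // m_cons; ring.
Qed.

Lemma create_diag_op i m a b :
  (forall w, m (i :: w) = a * m w + b) ->
  diag_op m * create_op i = a *: (create_op i * diag_op m) + b *: create_op i.
Proof.
move=> m_cons; apply: linop_eqP => x; apply/funext => -[|c w].
  by rewrite -[LHS]/(m [::] * 0) -[RHS]/(a * 0 + b * 0); ring.
rewrite -[LHS]/(m (c :: w) * ((i == c)%:R * x w)).
rewrite -[RHS]/(a * ((i == c)%:R * (m w * x w)) + b * ((i == c)%:R * x w)).
by have [<-|_] := eqVneq i c; rewrite ?m_cons ?mulr1n ?mulr0n; ring.
Qed.

(** This is the recursion for E read on coefficients. With [s j] the sign of exchanging i and j, it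
    becomes the relation for [e_i^+, e_j^-]. *)
Lemma annih_create d s i j :
  annih_op d s i * create_op j =
    (i == j)%:R *: diag_op d + s j *: (create_op j * annih_op d s i).
Proof.
apply: linop_eqP => x; apply/funext => -[|b w].
  rewrite -[LHS]/(d [::] * ((j == i)%:R * x [::]) + 0).
  by rewrite -[RHS]/((i == j)%:R * (d [::] * x [::]) + s j * 0) eq_sym; ring.
rewrite -[LHS]/(d (b :: w) * ((j == i)%:R * x (b :: w)) +
  s b * annih d s i ((j == b)%:R *: x) w).
rewrite -[RHS]/((i == j)%:R * (d (b :: w) * x (b :: w)) +
  s j * ((j == b)%:R * annih d s i x w)).
(* Homogeneity of [annih], read off from [linop_scaleAr] at the identity operator. *)
have -> : annih d s i ((j == b)%:R *: x) w = (j == b)%:R * annih d s i x w.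
  exact: (congr1 (fun f : linop K T => f x w)
    (esym (linop_scaleAr (j == b)%:R (annih_op d s i) 1))).
rewrite [j == i]eq_sym.
by have [<-|_] := eqVneq j b; rewrite ?mulr1n ?mulr0n; ring.
Qed.

End WordOperators.

(** * The Verma module as a representation of the presented superalgebra *)

Section VermaRepresentation.

Variables (K : fieldType) (n l : nat) (A : 'M[K]_n) (D : 'M[K]_(l, n)).
Variables (p : 'I_n -> bool) (lam : 'I_n -> K).
Hypothesis hK : 2%N \notin [pchar K].

Local Notation I := 'I_n.

(* Eigenvalue of a Cartan element on the word w, each letter j of w standing
   for e_j^- and so lowering the weight by mu j. *)
Definition word_weight (c : K) (mu : I -> K) (w : seq I) : K :=
  c - \sum_(j <- w) mu j.

(** The parity of a word, the empty word (highest weight vector) being even; [sign_op] below plays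
    the role of [P]. *)
Definition word_sign (w : seq I) : K := \prod_(j <- w) (-1) ^+ p j.

Lemma word_weight_perm c mu u v : perm_eq u v ->
  word_weight c mu u = word_weight c mu v.
Proof. by move=> uv; rewrite /word_weight (perm_big v). Qed.

Lemma word_weight_cons c mu i w :
  word_weight c mu (i :: w) = word_weight c mu w - mu i.
Proof. by rewrite /word_weight big_cons; ring. Qed.

Lemma word_sign_perm u v : perm_eq u v -> word_sign u = word_sign v.
Proof. by move=> uv; rewrite /word_sign (perm_big v). Qed.

Lemma word_sign_cons i w : word_sign (i :: w) = (-1) ^+ p i * word_sign w.
Proof. by rewrite /word_sign big_cons. Qed.

Lemma word_sign_sq w : word_sign w * word_sign w = 1.
Proof.
elim: w => [|i w IHw]; first by rewrite /word_sign big_nil mulr1.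
by rewrite word_sign_cons mulrACA IHw -signr_addb addbb mulr1.
Qed.

Definition sign_op : linop K I := diag_op word_sign.

Lemma sign_op_sq : sign_op * sign_op = 1.
Proof.
apply: linop_eqP => x; apply/funext => w.
by rewrite -[LHS]/(word_sign w * (word_sign w * x w)) mulrA word_sign_sq mul1r.
Qed.

Definition verma_lsa : lieSuperalgebra K :=
  involution_superalgebra hK sign_op_sq.

Definition cartan_op i : linop K I := diag_op (word_weight (lam i) (A i)).

(** Moving e_i^+ past e_j^- costs the sign (-1)^(p_i p_j) and, if i = j, leaves h_i acting on the
    rest of the word. The highest weight is [lam i] on h_i and 0 on each d_i. *)
Definition verma_chevalley : chevalley n l verma_lsa :=
  @Chevalley K n l verma_lsa
    (fun s i => if s
       then annih_op (word_weight (lam i) (A i))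
                     (fun j => (-1) ^+ (p i && p j)) i
       else create_op K i)
    cartan_op
    (fun i => diag_op (word_weight 0 (D i))).

Lemma diag_part m : inv_part sign_op false (diag_op m).
Proof.
rewrite /inv_part /twist (diag_comm word_sign) -mulrA sign_op_sq mulr1.
by rewrite expr0 scale1r.
Qed.

Lemma create_part i : inv_part sign_op (p i) (create_op K i).
Proof.
rewrite /inv_part /twist (create_diag_op (a := (-1) ^+ p i) (b := 0)).
  by rewrite scale0r addr0 -scalerAl -mulrA sign_op_sq mulr1.
by move=> w; rewrite word_sign_cons addr0.
Qed.

Lemma annih_part d s i : inv_part sign_op (p i) (annih_op d s i).
Proof.
rewrite /inv_part /twist (annih_diag_op _ _ (a := (-1) ^+ p i) (b := 0)).
- by rewrite scale0r addr0 -scalerAl -mulrA sign_op_sq mulr1.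
- exact: word_sign_perm.
- by move=> w; rewrite word_sign_cons mulrA -signr_addb addbb mul1r addr0.
Qed.

Lemma br_diag m x :
  inv_br sign_op (diag_op m) x = diag_op m * x - x * diag_op m.
Proof. exact: (inv_br_homo hK _ (diag_part m)). Qed.

Lemma br_diag_diag m m' : inv_br sign_op (diag_op m) (diag_op m') = 0.
Proof. by rewrite br_diag diag_comm subrr. Qed.

(** Serves both h_i and d_i: adding or removing the letter j shifts the eigenvalue by [mu j]. *)
Lemma br_diag_e c mu s j :
  inv_br sign_op (diag_op (word_weight c mu)) (chev_e verma_chevalley s j) =
    (sgn_of K s * mu j) *: chev_e verma_chevalley s j.
Proof.
rewrite br_diag; case: s => /=.
  rewrite (annih_diag_op _ _ (a := 1) (b := mu j)).
  - by rewrite scale1r addrC addKr mul1r.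
  - exact: word_weight_perm.
  - by move=> w; rewrite word_weight_cons; ring.
rewrite (create_diag_op (a := 1) (b := - mu j)).
  by rewrite scale1r addrC addKr mulN1r.
by move=> w; rewrite word_weight_cons; ring.
Qed.

Lemma verma_relations : chevalley_relations A D p verma_chevalley.
Proof.
split=> /=.
- by case=> i; [exact: annih_part | exact: create_part].
- by move=> i; exact: diag_part.
- by move=> i; exact: diag_part.
- move=> i j; rewrite /lsa_br /= (inv_br_homo hK _ (annih_part _ _ i)).
  rewrite (iter_twist_part _ (create_part j)) annih_create -scalerAl addrK.
  by rewrite scaler_nat.
- by move=> s i j; exact: br_diag_e.
- by move=> i j; exact: br_diag_diag.
- by move=> s i j; exact: br_diag_e.
- by move=> i j; exact: br_diag_diag.
- by move=> i j; exact: br_diag_diag.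
Qed.

(** h_i multiplies the coefficient of the empty word by [lam i]. *)
Lemma verma_h_neq0 i : lam i != 0 -> chev_h verma_chevalley i <> 0.
Proof.
move=> li /(congr1 (fun f : linop K I => f (fun=> 1) [::])) /=.
rewrite -[RHS]/(0 : K) /word_weight big_nil subr0 mulr1 => /eqP.
by rewrite (negPf li).
Qed.

End VermaRepresentation.

(** * Bracket calculus and homomorphisms *)

Section SuperalgebraTheory.

Variables (K : fieldType) (L : lieSuperalgebra K).
Implicit Types x y : L.

Lemma lsa_brDl x x' y : lsa_br (x + x') y = lsa_br x y + lsa_br x' y.
Proof. by have := lsa_br_linl y 1 x x'; rewrite !scale1r. Qed.

Lemma lsa_brDr x y y' : lsa_br x (y + y') = lsa_br x y + lsa_br x y'.
Proof. by have := lsa_br_linr x 1 y y'; rewrite !scale1r. Qed.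

Lemma lsa_br0l y : lsa_br 0 y = 0.
Proof. by apply: (addrI (lsa_br 0 y)); rewrite -lsa_brDl !addr0. Qed.

Lemma lsa_br0r x : lsa_br x 0 = 0.
Proof. by apply: (addrI (lsa_br x 0)); rewrite -lsa_brDr !addr0. Qed.

Lemma lsa_brZl a x y : lsa_br (a *: x) y = a *: lsa_br x y.
Proof. by have := lsa_br_linl y a x 0; rewrite lsa_br0l !addr0. Qed.

Lemma lsa_brZr a x y : lsa_br x (a *: y) = a *: lsa_br x y.
Proof. by have := lsa_br_linr x a y 0; rewrite lsa_br0r !addr0. Qed.

Lemma lsa_br_skewl q r x y : lsa_part q x -> lsa_part r y ->
  lsa_br x y = (- (-1) ^+ (q && r)) *: lsa_br y x.
Proof. by move=> xq yr; rewrite (lsa_br_skew xq yr) scaleNr. Qed.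

Lemma lsa_part_inj q r x : x != 0 -> lsa_part q x -> lsa_part r x -> q = r.
Proof.
move=> /eqP x0; case: q; case: r => // xq xr; case: x0.
  exact: lsa_part_direct xr xq.
exact: lsa_part_direct xq xr.
Qed.

(** An even element acts as a derivation, so eigenvalues add. *)
Lemma lsa_br_weight r x y z a b : lsa_part false x -> lsa_part r y ->
  lsa_br x y = a *: y -> lsa_br x z = b *: z ->
  lsa_br x (lsa_br y z) = (a + b) *: lsa_br y z.
Proof.
move=> x0 yr xy xz; rewrite (lsa_br_jacobi z x0 yr) xy xz expr0 scale1r.
by rewrite lsa_brZl lsa_brZr scalerDl.
Qed.

End SuperalgebraTheory.

Lemma lsa_hom0 (K : fieldType) (L M : lieSuperalgebra K) (f : L -> M) :
  lsa_hom f -> f 0 = 0.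
Proof.
by case=> flin _ _; have := flin (-1) 0 0; rewrite !scaleN1r !addNr.
Qed.

Lemma lsa_homZ (K : fieldType) (L M : lieSuperalgebra K) (f : L -> M) a x :
  lsa_hom f -> f (a *: x) = a *: f x.
Proof.
by move=> hf; case: (hf) => flin _ _; have := flin a x 0;
  rewrite (lsa_hom0 hf) !addr0.
Qed.

Lemma chevalley_relations_map (K : fieldType) (n l : nat) (A : 'M[K]_n)
    (D : 'M[K]_(l, n)) (p : 'I_n -> bool) (L M : lieSuperalgebra K)
    (f : L -> M) (c : chevalley n l L) :
  lsa_hom f -> chevalley_relations A D p c ->
  chevalley_relations A D p (chevalley_map f c).
Proof.
move=> hf [eP hP dP ee he hh de dd dh]; have f0 := lsa_hom0 hf.
case: (hf) => flin fpart fbr.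
split=> /=; do ?[by move=> *; apply: fpart]; move=> *;
  by rewrite -?fbr ?ee ?he ?hh ?de ?dd ?dh ?(lsa_homZ _ _ hf) //; case: eqP.
Qed.

(** * Nonvanishing of the Chevalley generators *)

Section CartanMatrixSuperalgebra.

Variables (K : fieldType) (n l : nat) (A : 'M[K]_n) (D : 'M[K]_(l, n)).
Variables (p : 'I_n -> bool) (g : lieSuperalgebra K) (c : chevalley n l g).
Hypothesis hK : 2%N \notin [pchar K].
Hypothesis cartan_g : superalgebra_with_cartan_matrix A D p c.

Lemma cartan_superalgebra_relations : chevalley_relations A D p c.
Proof.
case: cartan_g => _ _ [gt [ct [f [[rel _] hf _ -> _]]]].
exact: chevalley_relations_map.
Qed.

Lemma cartan_superalgebra_h_neq0 i : chev_h c i != 0.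
Proof.
case: cartan_g => _ _ [gt [ct [f [[_ univ] hf _ -> [[_ _ cap] _]]]]].
apply/eqP => /= fh0.
(* h_i would lie in the kernel of [f], which meets the Cartan span only in 0. *)
have hi0 : chev_h ct i = 0.
  apply: cap => //; exists (fun j => (i == j)%:R), (fun=> 0).
  rewrite [X in _ + X]big1 ?addr0 => [|j _]; last by rewrite scale0r.
  rewrite (bigD1 i) //= eqxx scale1r big1 ?addr0 // => j ji.
  by rewrite eq_sym (negPf ji) scale0r.
(* The highest weight equal to 1 on every h_j handles all indices. *)
have [F [hF [_ Fh _] _]] := univ _ _ (verma_relations A D p (fun=> 1) hK).
have Vh := @verma_h_neq0 K n l A D p (fun=> 1) hK i (oner_neq0 K).
by apply: Vh; rewrite -Fh hi0 (lsa_hom0 hF).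
Qed.

Lemma cartan_superalgebra_e_neq0 s i : chev_e c s i != 0.
Proof.
have rel := cartan_superalgebra_relations.
have := cartan_superalgebra_h_neq0 i; apply: contraNneq => e0.
have := rel_ee rel i i; rewrite eqxx mulr1n => <-.
by case: s e0 => ->; rewrite ?lsa_br0l ?lsa_br0r.
Qed.

End CartanMatrixSuperalgebra.

(** * Brackets of the reflected generators *)

Section ReflectedGenerators.

Variables (K : fieldType) (n l : nat) (A : 'M[K]_n) (D : 'M[K]_(l, n)).
Variables (p : 'I_n -> bool) (k : 'I_n) (g : lieSuperalgebra K).
Variable c : chevalley n l g.
Hypotheses (hsym : forall i, A i k = 0 <-> A k i = 0).
Hypotheses (hpk : p k = true) (hAkk : A k k = 0).
Hypothesis rel : chevalley_relations A D p c.
Hypothesis e_neq0 : forall s i, chev_e c s i != 0.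

Local Notation e := (chev_e c).
Local Notation h := (chev_h c).
Local Notation et := (reflected_e A k c).

(** The reflected generators test A_kj, whereas b and c test A_jk; [hsym] reconciles the two. *)
Lemma sym_eq0 j : (A k j == 0) = (A j k == 0).
Proof. by apply/eqP/eqP => /hsym. Qed.

Lemma refl_cE j : j != k -> refl_c A k j = (A k j != 0)%:R.
Proof.
by move=> jk; rewrite /refl_c (negPf jk) sym_eq0; case: eqP.
Qed.

Lemma br_ee s i j : i != j -> lsa_br (e s i) (e (~~ s) j) = 0.
Proof.
move=> ij; case: s => /=; first by rewrite (rel_ee rel) (negPf ij).
rewrite (lsa_br_skewl (rel_e_part rel _ _) (rel_e_part rel _ _)).
by rewrite (rel_ee rel) eq_sym (negPf ij) scaler0.
Qed.

(** The bracket of two odd elements is symmetric, so both orders give h_k. *)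
Lemma br_e_k s : lsa_br (e s k) (e (~~ s) k) = h k.
Proof.
case: s => /=; first by rewrite (rel_ee rel) eqxx.
rewrite (lsa_br_skewl (rel_e_part rel _ _) (rel_e_part rel _ _)).
by rewrite (rel_ee rel) eqxx hpk expr1 opprK scale1r.
Qed.

(** In the Jacobi expansion e_k and e_j of opposite signs commute, so only the action of h_k on e_j
    survives. *)
Lemma br_back s j : j != k ->
  lsa_br (e (~~ s) k) (lsa_br (e s k) (e s j)) =
    (sgn_of K s * A k j) *: e s j.
Proof.
move=> jk.
rewrite (lsa_br_jacobi _ (rel_e_part rel _ k) (rel_e_part rel _ k)).
have := br_e_k (~~ s); rewrite negbK => ->; rewrite (rel_he rel).
have := @br_ee (~~ s) k j; rewrite negbK eq_sym => -> //.
by rewrite lsa_br0r scaler0 addr0.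
Qed.

Lemma reflected_e_neq0 s j : et s j != 0.
Proof.
rewrite /reflected_e; case: (eqVneq j k) => [_|jk] //.
case: (eqVneq (A k j) 0) => [_|Akj] //=.
apply/eqP => b0; have := br_back s jk; rewrite b0 lsa_br0r => /esym/eqP.
rewrite scaler_eq0 mulf_eq0 (negPf Akj) (negPf (e_neq0 s j)) /sgn_of.
by case: s {b0}; rewrite ?oppr_eq0 oner_eq0.
Qed.

Lemma reflected_e_part s j : lsa_part (p j (+) ((j != k) && (A k j != 0)))
  (et s j).
Proof.
rewrite /reflected_e; case: (eqVneq j k) => [->|_] /=.
  by rewrite addbF; exact: (rel_e_part rel).
case: (eqVneq (A k j) 0) => _ /=.
  by rewrite addbF; exact: (rel_e_part rel).
rewrite addbC -hpk.
exact: lsa_br_part (rel_e_part rel _ _) (rel_e_part rel _ _).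
Qed.

(** The number c_j counts how often the root k is added to the root j: -2 turns it into its negative
    for j = k, and 1 stands for a bracket with e_k^+. *)
Lemma br_h_reflected_e i j :
  lsa_br (h i) (et true j) = (A i j + (refl_c A k j)%:~R * A i k) *: et true j.
Proof.
rewrite /reflected_e; case: (eqVneq j k) => [->|jk].
  rewrite (rel_he rel) /refl_c eqxx /sgn_of; congr (_ *: _).
  by rewrite /=; ring.
rewrite refl_cE //; case: (eqVneq (A k j) 0) => _ /=.
  by rewrite (rel_he rel) mul1r mul0r addr0.
rewrite (lsa_br_weight (rel_h_part rel i) (rel_e_part rel _ _)
  (rel_he rel _ _ _) (rel_he rel _ _ _)) /sgn_of.
by congr (_ *: _); ring.
Qed.

Lemma reflected_h_k : reflected_h A k c k = h k.
Proof. by rewrite /reflected_h /reflected_e eqxx; exact: (br_e_k false). Qed.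

Lemma reflected_h_far i : i != k -> A k i = 0 -> reflected_h A k c i = h i.
Proof.
move=> ik Aki; rewrite /reflected_h /reflected_e (negPf ik) Aki eqxx /=.
by rewrite (rel_ee rel) eqxx.
Qed.

(** Expand with x = [e_k^+, e_i^+] acting on [e_k^-, e_i^-]. By [br_back], [x, e_k^-] is a multiple
    of e_i^+ and yields h_i; [x, e_i^-] is a multiple of e_k^+ and yields h_k. *)
Lemma reflected_h_near i : i != k -> A k i != 0 ->
  reflected_h A k c i = (-1) ^+ p i *: (A k i *: h i + A i k *: h k).
Proof.
move=> ik Aki; rewrite /reflected_h /reflected_e (negPf ik) Aki.
have kP s := rel_e_part rel s k; have iP s := rel_e_part rel s i.
have xP := lsa_br_part (kP true) (iP true).
rewrite (lsa_br_jacobi _ xP (kP false)).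
rewrite (lsa_br_skewl xP (kP false)) (br_back true ik) hpk.
(* Jacobi for e_k^+, e_i^+, e_i^-: since [e_k^+, e_i^-] = 0, the bracket equals [e_k^+, h_i]. *)
have -> : lsa_br (lsa_br (e true k) (e true i)) (e false i) =
    - (A i k *: e true k).
  have := lsa_br_jacobi (e false i) (kP true) (iP true).
  have := @br_ee true k i; rewrite eq_sym => -> //.
  rewrite lsa_br0r scaler0 addr0 => <-.
  rewrite (rel_ee rel) eqxx mulr1n.
  rewrite (lsa_br_skewl (kP true) (rel_h_part rel i)) andbF expr0.
  by rewrite (rel_he rel) scaleN1r mul1r.
rewrite lsa_brZl lsa_brZl (rel_ee rel) eqxx mulr1n -scaleN1r scalerA.
rewrite ?lsa_brZr (br_e_k false : lsa_br (e false k) (e true k) = h k)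
  scalerDr !scalerA.
by congr (_ *: _ + _ *: _); case: (p i) => /=; rewrite ?expr0 ?expr1; ring.
Qed.

(** The factors taking the eigenvalues of h~_i to the rows of r_k(A). Row k gets -1 because b_k = -2
    and A_kk = 0 make it the negative of row k of A; otherwise the coefficient of h_i in h~_i is
    divided out. *)
Definition refl_scale (i : 'I_n) : K :=
  if i == k then -1 else if A k i == 0 then 1 else (-1) ^+ p i / A k i.

Lemma refl_scale_neq0 i : refl_scale i != 0.
Proof.
rewrite /refl_scale; case: (eqVneq i k) => _.
  by rewrite oppr_eq0 oner_eq0.
case: (eqVneq (A k i) 0) => [_|Aki]; first exact: oner_neq0.
by rewrite mulf_neq0 ?invr_eq0 ?signr_eq0.
Qed.

Lemma reflected_cartan_entry i j :
  lsa_br (reflected_h A k c i) (et true j) =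
    ((refl_scale i)^-1 * refl_mx A k i j) *: et true j.
Proof.
rewrite mxE /refl_scale /refl_b.
case: (eqVneq i k) => [->|ik].
  rewrite reflected_h_k br_h_reflected_e hAkk; congr (_ *: _).
  by rewrite invrN invr1; ring.
rewrite -sym_eq0; case: (eqVneq (A k i) 0) => [Aki|Aki].
  by rewrite reflected_h_far // br_h_reflected_e invr1; congr (_ *: _); ring.
rewrite reflected_h_near // lsa_brZl lsa_brDl !lsa_brZl !br_h_reflected_e.
rewrite hAkk !scalerA -scalerDl scalerA; congr (_ *: _).
by rewrite invf_div invr_sign; field.
Qed.

End ReflectedGenerators.

(** * The matrix form of the reflection *)

Section ReflectionMatrices.

Variables (K : fieldType) (n : nat) (A : 'M[K]_n) (k : 'I_n).

(** Only column k of B is nonzero, so squaring multiplies B by its diagonal entry b_k = -2; likewise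
    for row k of C. *)
Lemma refl_B_sq : refl_B A k *m refl_B A k = -2 *: refl_B A k.
Proof.
apply/matrixP => i j; rewrite !mxE (bigD1 k) //= big1 ?addr0 => [|a ak].
  rewrite !mxE eqxx; case: eqP => _; last by rewrite !mulr0.
  by rewrite /refl_b eqxx mulrC.
by rewrite !mxE (negPf ak) mul0r.
Qed.

Lemma refl_C_sq : refl_C A k *m refl_C A k = -2 *: refl_C A k.
Proof.
apply/matrixP => i j; rewrite !mxE (bigD1 k) //= big1 ?addr0 => [|a ak].
  rewrite !mxE eqxx; case: eqP => _; last by rewrite mul0r mulr0.
  by rewrite {1}/refl_c eqxx.
by rewrite !mxE (negPf ak) mulr0.
Qed.

(** The product expands to A + BA + AC + BAC, and BAC has entries b_i A_kk c_j = 0. *)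
Lemma refl_mxE : A k k = 0 ->
  refl_mx A k = (1%:M + refl_B A k) *m A *m (1%:M + refl_C A k).
Proof.
move=> hAkk; rewrite mulmxDr mulmx1 mulmxDl mul1mx.
have BA i j : (refl_B A k *m A) i j = refl_b A k i * A k j.
  rewrite mxE (bigD1 k) //= big1 ?addr0 => [|a ak]; rewrite !mxE ?eqxx //.
  by rewrite (negPf ak) mul0r.
apply/matrixP => i j; rewrite mxE [RHS]mxE [(A + _) i j]mxE BA; congr (_ + _).
rewrite mxE (bigD1 k) //= big1 ?addr0 => [|a ak]; last first.
  by rewrite [refl_C _ _ _ _]mxE (negPf ak) mulr0.
by rewrite mxE BA hAkk mulr0 addr0 mxE eqxx mulrC.
Qed.

(** The terms 2M and M^2 cancel, so E+B and E+C are their own inverses. *)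
Lemma unipotent_sq (M : 'M[K]_n) : M *m M = -2 *: M ->
  (1%:M + M) *m (1%:M + M) = 1%:M.
Proof.
move=> MM; rewrite mulmxDl mul1mx mulmxDr mulmx1 MM scaleNr scaler_nat mulr2n.
by rewrite [M + _]addrC opprD addrNK addrK.
Qed.

End ReflectionMatrices.

Lemma invol_unitmx (K : fieldType) (n : nat) (M : 'M[K]_n) :
  M *m M = 1%:M -> M \in unitmx /\ invmx M = M.
Proof.
move=> MM; have [Mu _] := mulmx1_unit MM; split=> //.
by rewrite -[LHS]mulmx1 -MM mulKmx.
Qed.

(** The value -2 is c_k, which leaves the parity unchanged. *)
Lemma parity_modz (q b : bool) (z : int) (d : bool) :
  (z = d :> int \/ z = -2 /\ d = false) ->
  ((q : nat)%:Z = (b : nat)%:Z + z %[mod 2])%Z <-> q = b (+) d.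
Proof.
by case=> [->|[-> ->]]; [case: d|]; case: q; case: b.
Qed.

Theorem mainTheorem1 (K : fieldType) (hK : 2%N \notin [pchar K]) (n : nat)
    (A : 'M[K]_n) (p : 'I_n -> bool) (k : 'I_n)
    (hsym : forall i, A i k = 0 <-> A k i = 0)
    (hpk : p k = true) (hAkk : A k k = 0) :
  (forall (l : nat) (D : 'M[K]_(l, n)) (g : lieSuperalgebra K)
          (c : chevalley n l g),
     superalgebra_with_cartan_matrix A D p c ->
     (exists At : 'M[K]_n,
        unique (reflected_cartan_matrix A k c) At /\
        row_rescaling At (refl_mx A k)) /\
     (forall (s : bool) (j : 'I_n) (q : bool),
        lsa_part q (reflected_e A k c s j) <->
        ((q : nat)%:Z = (p j : nat)%:Z + refl_c A k j %[mod 2])%Z)) /\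
  refl_mx A k = (1%:M + refl_B A k) *m A *m (1%:M + refl_C A k) /\
  refl_B A k *m refl_B A k = -2 *: refl_B A k /\
  refl_C A k *m refl_C A k = -2 *: refl_C A k /\
  (A \in unitmx ->
     refl_mx A k \in unitmx /\
     invmx (refl_mx A k)
       = (1%:M + refl_C A k) *m invmx A *m (1%:M + refl_B A k)).
Proof.
split=> [l D g c cartan_g|]; last first.
  split; first exact: refl_mxE.
  split; first exact: refl_B_sq.
  split; first exact: refl_C_sq.
  move=> Au; rewrite refl_mxE //.
  have [Bu Bi] := invol_unitmx (unipotent_sq (refl_B_sq A k)).
  have [Cu Ci] := invol_unitmx (unipotent_sq (refl_C_sq A k)).
  have BAu : (1%:M + refl_B A k) *m A \in unitmx by rewrite unitmx_mul Bu.
  split; first by rewrite unitmx_mul BAu.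
  have inv_mul (M N : 'M[K]_n) : M \in unitmx -> N \in unitmx ->
      invmx (M *m N) = invmx N *m invmx M.
    move=> Mu Nu; have MNu : M *m N \in unitmx by rewrite unitmx_mul Mu.
    apply: (can_inj (mulKmx MNu)); rewrite mulmxV // mulmxA.
    by rewrite -[M *m N *m _]mulmxA mulmxV // mulmx1 mulmxV.
  by rewrite !inv_mul // Bi Ci mulmxA.
have rel := cartan_superalgebra_relations cartan_g.
have e_neq0 := cartan_superalgebra_e_neq0 hK cartan_g.
have et_neq0 := reflected_e_neq0 hpk rel e_neq0.
have entry := reflected_cartan_entry hsym hpk hAkk rel.
split.
  (* The witness consists of the eigenvalues themselves, before rescaling. *)
  exists (\matrix_(i, j) ((refl_scale A p k i)^-1 * refl_mx A k i j)).
  split; first split.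
  - by move=> i j; rewrite entry [in RHS]mxE.
  - move=> M HM; apply/matrixP => i j; rewrite mxE.
    (* A nonzero vector has at most one eigenvalue. *)
    have /eqP := HM i j; rewrite entry -subr_eq0 -scalerBl scaler_eq0.
    by rewrite (negPf (et_neq0 _ _)) orbF subr_eq0 => /eqP.
  - exists (\row_i refl_scale A p k i); split=> [i|].
      by rewrite mxE refl_scale_neq0.
    apply/matrixP => i j; rewrite mul_diag_mx [RHS]mxE !mxE.
    by rewrite mulVKf ?refl_scale_neq0.
move=> s j q; have etP := reflected_e_part hpk rel s j.
rewrite (@parity_modz q (p j) _ ((j != k) && (A k j != 0))); last first.
  have [->|jk] /= := eqVneq j k; first by right; rewrite /refl_c eqxx.
  by left; rewrite (refl_cE hsym jk); case: (A k j != 0).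
(* A nonzero vector has at most one parity. *)
split=> [etq|->] //; exact: lsa_part_inj (et_neq0 s j) etq etP.
Qed.
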